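(* Let $X:\Omega\to\mathbb{C}^{N\times m}$ be a solution of the Grassmannian sigma model equations with associated surface $Z:\Omega\to\mathfrak{su}(N)$, and suppose $\det G=J_LJ_R-G_{LR}^2\neq 0$ on $\Omega$. Then the Gaussian curvature of the surface, i.e. of the induced metric $J_L(d\xi_L)^2+2G_{LR}\,d\xi_L d\xi_R+J_R(d\xi_R)^2$, is $$K=\frac{1}{\sqrt{J_LJ_R-G_{LR}^2}}\;\partial_R\left(\frac{\partial_L G_{LR}-\frac12 G_{LR}\,\partial_L(\ln J_L)}{\sqrt{J_LJ_R-G_{LR}^2}}\right).$$
   Context: Let $m,n\ge 1$ and $N=m+n$. Let $\Omega\subset\mathbb{R}^2$ be open, connected and simply connected, with light-cone coordinates $\xi_L=\xi^0+\xi^1$, $\xi_R=\xi^0-\xi^1$, and write $\partial_L=\partial/\partial\xi_L$, $\partial_R=\partial/\partial\xi_R$. A dagger denotes the conjugate transpose, and $\partial_D X^\dagger=\partial_D(X^\dagger)=(\partial_D X)^\dagger$. A smooth map $X:\Omega\to\mathbb{C}^{N\times m}$ with $X^\dagger X=\mathbf{1}_{m\times m}$ represents a map into the Grassmannian $G(m,n)=SU(N)/S(U(m)\times U(n))$. Put $P=\mathbf{1}-XX^\dagger$, an orthogonal projector. $X$ is called a solution of the Grassmannian sigma model (Euler--Lagrange) equations if $[\partial_L\partial_R P,P]=0$ on $\Omega$, equivalently $\partial_L[\partial_R P,P]+\partial_R[\partial_L P,P]=0$. The algebra $\mathfrak{su}(N)$ of traceless anti-Hermitian $N\times N$ matrices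 is equipped with the scalar product $(A,B)=-\frac12\operatorname{tr}(AB)$ and so identified with Euclidean space $\mathbb{R}^{N^2-1}$. For a solution $X$, the associated surface is the smooth map $Z:\Omega\to\mathfrak{su}(N)$, unique up to an additive constant, with $$\partial_L Z=[\partial_L P,P],\qquad \partial_R Z=-[\partial_R P,P].$$ The components of the induced metric $G$ are $G_{LL}=J_L$, $G_{RR}=J_R$ and $G_{LR}$, where $$J_D=(\partial_D Z,\partial_D Z)=\operatorname{tr}(\partial_D X\,\partial_D X^\dagger P)\ (D=L,R),\qquad G_{LR}=(\partial_L Z,\partial_R Z)=-\tfrac12\operatorname{tr}\big((\partial_L X\,\partial_R X^\dagger+\partial_R X\,\partial_L X^\dagger)P\big).$$ *)

(* Defs.v *)
From HB Require Import structures.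
From mathcomp Require Import all_boot all_order all_algebra.
From mathcomp Require Import complex.
From mathcomp Require Import all_classical all_reals all_analysis.

Set Implicit Arguments.
Unset Strict Implicit.
Unset Printing Implicit Defensive.

Import Order.TTheory GRing.Theory Num.Theory.
Import numFieldNormedType.Exports.

Local Open Scope classical_set_scope.
Local Open Scope ring_scope.
Local Open Scope complex_scope.
Local Open Scope sesquilinear_scope.

Section Domain.
Variable R : realType.

(* Every loop contracts inside D, with the base point held fixed. Path
   connectedness is not part of the definition: it is to be combined with
   [open D] and [connected D]. *)
Definition simply_connected (D : set (R * R)) : Prop :=
  forall gamma : R -> R * R,
    {within `[0, 1], continuous gamma} ->
    (forall t, 0 <= t <= 1 -> D (gamma t)) ->
    gamma 0 = gamma 1 ->
  exists H : R * R -> R * R,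
    [/\ {within `[0, 1]%classic `*` `[0, 1]%classic, continuous H},
        forall s t, 0 <= s <= 1 -> 0 <= t <= 1 -> D (H (s, t)),
        forall t, 0 <= t <= 1 -> H (0, t) = gamma t,
        forall t, 0 <= t <= 1 -> H (1, t) = gamma 0 &
        forall s, 0 <= s <= 1 -> H (s, 0) = gamma 0 /\ H (s, 1) = gamma 0].

(* All iterated directional derivatives exist and are (Frechet) differentiable
   at every point of D; for open D this is C^oo on D. *)
Definition smooth_on (D : set (R * R)) (f : R * R -> R) : Prop :=
  forall (vs : seq (R * R)) (p : R * R), D p ->
    differentiable (foldr (fun v g => 'D_v g) f vs) p.

(* Points of R^2 are pairs (xi^0, xi^1). Since xi^0 = (xi_L + xi_R) / 2 and
   xi^1 = (xi_L - xi_R) / 2, the operators d/dxi_L and d/dxi_R are the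
   directional derivatives along the following two vectors. *)
Definition eL : R * R := (2^-1, 2^-1).
Definition eR : R * R := (2^-1, - 2^-1).

End Domain.

Section MatrixFunctions.
Variable R : realType.
Variables k l : nat.
Implicit Types (A : R * R -> 'M[R[i]]_(k, l)) (D : set (R * R)).

Definition smooth_mx D A : Prop :=
  forall i j, smooth_on D (fun p => complex.Re (A p i j)) /\
              smooth_on D (fun p => complex.Im (A p i j)).

(* Directional derivative, taken on the real and imaginary parts of entries. *)
Definition derive_mx (v : R * R) A (p : R * R) : 'M[R[i]]_(k, l) :=
  \matrix_(i, j) ('D_v (fun q => complex.Re (A q i j)) p +i*
                  'D_v (fun q => complex.Im (A q i j)) p).

End MatrixFunctions.

Section SuN.
Variable R : realType.
Variable N : nat.
Implicit Types A B : 'M[R[i]]_N.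

Definition commutator_mx A B : 'M[R[i]]_N := A *m B - B *m A.

Definition in_su A : Prop := A ^t* = - A /\ \tr A = 0.

(* For A and B in su(N) the trace of A *m B is real, so that taking the real
   part only changes the type. *)
Definition su_dot A B : R := complex.Re (- 2^-1 * \tr (A *m B)).

End SuN.

Section SigmaModel.
Variable R : realType.
Variables m n : nat.
Implicit Types (X : R * R -> 'M[R[i]]_(m + n, m)) (D : set (R * R))
               (Z : R * R -> 'M[R[i]]_(m + n)).

Definition grassmannian_map D X : Prop :=
  smooth_mx D X /\ forall p, D p -> (X p) ^t* *m X p = 1%:M.

Definition projP X (p : R * R) : 'M[R[i]]_(m + n) := 1%:M - X p *m (X p) ^t*.

Definition sigma_model_solution D X : Prop :=
  grassmannian_map D X /\
  forall p, D p ->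
    commutator_mx (derive_mx (eL R) (derive_mx (eR R) (projP X)) p) (projP X p)
    = 0.

Definition associated_surface D X Z : Prop :=
  [/\ smooth_mx D Z,
      forall p, D p -> in_su (Z p),
      forall p, D p -> derive_mx (eL R) Z p =
                       commutator_mx (derive_mx (eL R) (projP X) p) (projP X p) &
      forall p, D p -> derive_mx (eR R) Z p =
                     - commutator_mx (derive_mx (eR R) (projP X) p) (projP X p)].

End SigmaModel.

Section Curvature.
Variable R : realType.
Implicit Types (e : 'I_2 -> R * R) (g : R * R -> 'M[R]_2).

(* A metric on a plane domain is given by its components g p i j in the linear
   coordinates x^0, x^1 whose coordinate fields d/dx^i are the directional
   derivatives along the constant vectors e i. *)

(* Gamma^a_{ij} *)
Definition christoffel e g (a i j : 'I_2) (p : R * R) : R :=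
  2^-1 * \sum_(b < 2) invmx (g p) a b *
    ('D_(e i) (fun q => g q b j) p + 'D_(e j) (fun q => g q b i) p
     - 'D_(e b) (fun q => g q i j) p).

(* The d/dx^a component of R(d/dx^i, d/dx^j) d/dx^k, with the convention
   R(U, V) W = nabla_U nabla_V W - nabla_V nabla_U W - nabla_[U, V] W. *)
Definition riemann e g (a k i j : 'I_2) (p : R * R) : R :=
  'D_(e i) (christoffel e g a j k) p - 'D_(e j) (christoffel e g a i k) p
  + \sum_(s < 2) (christoffel e g a i s p * christoffel e g s j k p
                  - christoffel e g a j s p * christoffel e g s i k p).

(* K = g(R(d_0, d_1) d_1, d_0) / det g *)
Definition gaussian_curvature e g (p : R * R) : R :=
  (\sum_(a < 2) g p 0 a * riemann e g a 1 0 1 p) / \det (g p).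

End Curvature.

Section InducedMetric.
Variable R : realType.
Variable N : nat.
Implicit Types Z : R * R -> 'M[R[i]]_N.

Definition frameLR (i : 'I_2) : R * R := if i == 0 then eL R else eR R.

Definition induced_metric Z (p : R * R) : 'M[R]_2 :=
  \matrix_(i, j) su_dot (derive_mx (frameLR i) Z p) (derive_mx (frameLR j) Z p).

Definition J_L Z (p : R * R) : R :=
  su_dot (derive_mx (eL R) Z p) (derive_mx (eL R) Z p).
Definition J_R Z (p : R * R) : R :=
  su_dot (derive_mx (eR R) Z p) (derive_mx (eR R) Z p).
Definition G_LR Z (p : R * R) : R :=
  su_dot (derive_mx (eL R) Z p) (derive_mx (eR R) Z p).

End InducedMetric.

(* Main.v *)
(* The field equation gives d_L d_R Z = [d_L P, d_R P]. Differentiating P^2 = P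
   shows that d_L P and d_R P exchange the range and the kernel of P, so this
   matrix commutes with P and is orthogonal to [C, P] for every C, in particular
   to d_L Z and d_R Z. Hence d_R J_L = 0 and d_L J_R = 0: the light-cone
   coordinates form a Chebyshev net, the mixed Christoffel symbols vanish and the
   Gauss equation collapses to the stated formula. On anti-Hermitian matrices the
   scalar product is positive semidefinite, so by Cauchy-Schwarz det G is positive
   where it does not vanish, and then J_L > 0. *)

Require Import Defs.
From HB Require Import structures.
From mathcomp Require Import all_boot all_order all_algebra.
From mathcomp Require Import complex.
From mathcomp Require Import all_classical all_reals all_analysis.
From mathcomp Require Import ring lra.

Import Order.TTheory GRing.Theory Num.Theory.
Import numFieldNormedType.Exports.

Local Open Scope classical_set_scope.
Local Open Scope ring_scope.
Local Open Scope complex_scope.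

(** * Directional derivatives: chain rule, quotient rule and symmetry of mixed derivatives *)

Section DirectionalDerivatives.
Context {R : realType} {V : normedModType R}.
Implicit Types (f g : V -> R) (D : set V) (p v w : V).

(** The two difference quotients are the same function of [h]. This transfers one-variable results,
    such as the mean value theorem, to directional derivatives. *)
Lemma is_derive_line f v p (t : R) :
  derivable f (t *: v + p) v ->
  is_derive t 1 (fun s : R => f (s *: v + p)) ('D_v f (t *: v + p)).
Proof.
move=> df.
have E : (fun h : R => h^-1 *: (((fun s : R => f (s *: v + p)) \o shift t) (h *: 1)
            - f (t *: v + p))) =
         (fun h : R => h^-1 *: ((f \o shift (t *: v + p)) (h *: v) - f (t *: v + p))).
  by apply/funext => h /=; rewrite scalerDl -addrA [h *: 1]mulr1.
by split; rewrite /derivable /derive E.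
Qed.

(** Restricting [f] to the line through [p] along [v] reduces this to the one-variable chain rule,
    so derivability of [f] in the single direction [v] suffices. *)
Lemma is_derive_comp_line f (g : R -> R) p v (df dg : R) :
  is_derive p v f df -> is_derive (f p) 1 g dg ->
  is_derive p v (fun q => g (f q)) (dg * df).
Proof.
move=> Hf Hg.
have p0 : 0 *: v + p = p by rewrite scale0r add0r.
have H0 : is_derive (0 : R) 1 (fun s : R => f (s *: v + p)) df.
  have := @is_derive_line f v p 0; rewrite p0 => /(_ (@ex_derive _ _ _ _ _ _ _ Hf)).
  by rewrite derive_val.
have H1 : is_derive (0 : R) 1 (fun s : R => g (f (s *: v + p))) (dg * df).
  by apply: is_derive1_comp; rewrite ?p0.
have E : (fun h : R => h^-1 *: (((fun s : R => g (f (s *: v + p))) \o shift 0) (h *: 1)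
            - g (f (0 *: v + p)))) =
         (fun h : R => h^-1 *: (((fun q => g (f q)) \o shift p) (h *: v) - g (f p))).
  by apply/funext => h /=; rewrite p0 addr0 [h *: 1]mulr1.
by case: H1; rewrite /derivable /derive E.
Qed.

Lemma is_derive_div f g p v (df dg : R) : g p != 0 ->
  is_derive p v f df -> is_derive p v g dg ->
  is_derive p v (fun q => f q / g q) ((df * g p - f p * dg) / g p ^+ 2).
Proof.
move=> g0 Hf Hg.
have dg' := @ex_derive _ _ _ _ _ _ _ Hg.
have Hi := DeriveDef (derivableV g0 dg') (deriveV g0 dg').
apply: is_derive_eq (is_deriveM Hf Hi) _.
rewrite (@derive_val _ _ _ _ _ _ _ Hg) -![_ *: _]/(_ * _).
by field.
Qed.

(* Two applications of the mean value theorem; exchanging v and w leaves the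
   second difference unchanged, which gives the symmetry of second derivatives. *)
Lemma second_difference D f p v w (h : R) : 0 <= h ->
  (forall s t, 0 <= s <= h -> 0 <= t <= h -> D (s *: v + (t *: w + p))) ->
  (forall q, D q -> derivable f q v) ->
  (forall q, D q -> derivable ('D_v f) q w) ->
  exists2 q, D q &
    f (h *: v + (h *: w + p)) - f (h *: v + p) - f (h *: w + p) + f p =
    'D_w ('D_v f) q * h * h.
Proof.
move=> h0 HD df ddf.
have h0i : 0 <= (0 : R) <= h by rewrite lexx.
have hhi : 0 <= h <= h by rewrite lexx h0.
have D0 s : 0 <= s <= h -> D (s *: v + p).
  by move=> sh; have := HD s 0 sh h0i; rewrite scale0r add0r.
(* The second difference is the increment of [g] over [0, h]. *)
pose g (s : R) := f (s *: v + (h *: w + p)) - f (s *: v + p).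
pose dg (s : R) := 'D_v f (s *: v + (h *: w + p)) - 'D_v f (s *: v + p).
have Hg s : 0 <= s <= h -> is_derive s 1 g (dg s).
  move=> sh; rewrite /g /dg; apply: is_deriveB.
    by apply: is_derive_line; apply: df; apply: HD.
  by apply: is_derive_line; apply: df; apply: D0.
have [||s] := @MVT_segment R g dg 0 h h0.
- by move=> s; rewrite in_itv/= => /andP[/ltW s0 /ltW sh]; apply: Hg; rewrite s0.
- apply: derivable_within_continuous => s; rewrite in_itv/= => /Hg Hs.
  exact: (@ex_derive _ _ _ _ _ _ _ Hs).
rewrite in_itv/= => shi E.
(* The value [dg s] produced by the first application is itself the increment of [k] over [0, h]. *)
pose k (t : R) := 'D_v f (t *: w + (s *: v + p)).
pose dk (t : R) := 'D_w ('D_v f) (t *: w + (s *: v + p)).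
have Hk t : 0 <= t <= h -> is_derive t 1 k (dk t).
  move=> th; apply: is_derive_line; apply: ddf.
  by rewrite addrCA; apply: HD.
have [||t] := @MVT_segment R k dk 0 h h0.
- by move=> t; rewrite in_itv/= => /andP[/ltW t0 /ltW th]; apply: Hk; rewrite t0.
- apply: derivable_within_continuous => t; rewrite in_itv/= => /Hk Ht.
  exact: (@ex_derive _ _ _ _ _ _ _ Ht).
rewrite in_itv/= => thi E'.
exists (s *: v + (t *: w + p)); first exact: HD.
move: E E'; rewrite /g /dg /k /dk !scale0r !add0r !subr0.
rewrite ![_ + (s *: v + p)]addrCA => E E'.
by rewrite -E' -E; ring.
Qed.

(** On a small parallelogram at [p], one second difference equals h^2 times either mixed derivative,
    each taken at some point near [p]; continuity at [p] then compares the two values there. *)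
Lemma derive_symmetric D f p v w : open D -> D p ->
  (forall q, D q -> derivable f q v) -> (forall q, D q -> derivable f q w) ->
  (forall q, D q -> derivable ('D_v f) q w) ->
  (forall q, D q -> derivable ('D_w f) q v) ->
  {for p, continuous ('D_w ('D_v f))} -> {for p, continuous ('D_v ('D_w f))} ->
  'D_w ('D_v f) p = 'D_v ('D_w f) p.
Proof.
move=> oD Dp fv fw fvw fwv cvw cwv.
apply/eqP; rewrite -subr_eq0 -normr_le0; apply/ler_addgt0Pl => e e0; rewrite addr0.
have e20 : 0 < e / 2 by rewrite divr_gt0.
have Dn : nbhs p D by exact: open_nbhs_nbhs.
move/cvgrPdist_lt : cvw => /(_ _ e20) cvw.
move/cvgrPdist_lt : cwv => /(_ _ e20) cwv.
have : nbhs p [set q | [/\ D q, `|'D_w ('D_v f) p - 'D_w ('D_v f) q| < e / 2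
                        & `|'D_v ('D_w f) p - 'D_v ('D_w f) q| < e / 2]].
  have Q : nbhs p (D `&` ([set q | `|'D_w ('D_v f) p - 'D_w ('D_v f) q| < e / 2]
    `&` [set q | `|'D_v ('D_w f) p - 'D_v ('D_w f) q| < e / 2])).
    exact: (@filterI _ (nbhs p) _ _ _ Dn (@filterI _ (nbhs p) _ _ _ cvw cwv)).
  apply: (@filterS _ (nbhs p) _ _ _ _ Q); move=> q; case=> H1; case=> H2 H3.
  exact: (And3 H1 H2 H3).
move=> /nbhs_ballP[r /= r0 Hr].
(* With this [M], the parallelogram with sides [h *: v] and [h *: w] stays within distance h M = r /
   2 of [p]; the summand 1 keeps [M] positive when both vectors vanish. *)
pose M := `|v| + `|w| + 1.
have M0 : 0 < M by rewrite ltr_wpDl // addr_ge0.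
pose h := r / (2 * M).
have h0 : 0 < h by rewrite divr_gt0 // mulr_gt0.
have near_p s t : 0 <= s <= h -> 0 <= t <= h -> ball p r (s *: v + (t *: w + p)).
  move=> /andP[s0 sh] /andP[t0 th]; rewrite -ball_normE /=.
  rewrite addrA [X in p - X]addrC opprD addrA subrr add0r normrN.
  have : `|s *: v + t *: w| <= h * M.
    rewrite (le_trans (ler_normD _ _)) // !normrZ !ger0_norm // /M !mulrDr mulr1.
    rewrite -[leLHS]addr0 lerD ?(ltW h0) //.
    by rewrite lerD // ler_wpM2r.
  move=> /le_lt_trans; apply; rewrite /h invfM mulrA divfK ?gt_eqF //.
  by rewrite ltr_pdivrMr // ltr_pMr // ltr1n.
have near_p' s t : 0 <= s <= h -> 0 <= t <= h -> ball p r (s *: w + (t *: v + p)).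
  by move=> si ti; rewrite addrCA; exact: near_p.
have BD q : ball p r q -> D q by move=> /Hr[].
have [q Bq E] := @second_difference (ball p r) f p v w h (ltW h0) near_p
  (fun q Bq => fv q (BD q Bq)) (fun q Bq => fvw q (BD q Bq)).
have [q' Bq' E'] := @second_difference (ball p r) f p w v h (ltW h0) near_p'
  (fun q Bq => fw q (BD q Bq)) (fun q Bq => fwv q (BD q Bq)).
have [_ H1 _] := Hr _ Bq.
have [_ _ H2] := Hr _ Bq'.
(* Cancelling [h] twice, equal second differences give equal mixed derivatives at [q] and [q']; each
   lies within [e / 2] of the corresponding value at [p]. *)
have key (a b x y a0 b0 : R) : x = a * h * h -> y = b * h * h -> x = y ->
    `|a0 - a| < e / 2 -> `|b0 - b| < e / 2 -> `|a0 - b0| <= e.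
  move=> -> -> ab Ha Hb.
  have ha : a = b by apply: (mulIf (lt0r_neq0 h0)); exact: (mulIf (lt0r_neq0 h0)).
  rewrite (_ : a0 - b0 = (a0 - a) - (b0 - b)); last by rewrite ha; ring.
  by rewrite (le_trans (ler_normB _ _)) // [leRHS](splitr e) lerD // ltW.
apply: (key _ _ _ _ _ _ E E' _ H1 H2).
by rewrite [h *: w + (h *: v + p)]addrCA; ring.
Qed.

End DirectionalDerivatives.

(** * Functions of class C^k and their closure under algebraic operations *)

Section ContinuouslyDerivable.
Context {R : realType} {V : normedModType R}.
Implicit Types (f g : V -> R) (D : set V) (p v w : V) (k : nat).

(* Functions of class C^k on D. Only directional derivatives occur, so that, for
   open D, the class depends only on the values of f on D (see [eq_on_Ck]). *)
Fixpoint Ck k D f : Prop :=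
  (forall p, D p -> {for p, continuous f}) /\
  if k is k'.+1 then forall v, (forall p, D p -> derivable f p v) /\ Ck k' D ('D_v f)
  else True.

Lemma near_open D (P : V -> Prop) p : open D -> D p -> (forall q, D q -> P q) ->
  \forall q \near p, P q.
Proof.
move=> oD Dp DP; have : nbhs p D by exact: open_nbhs_nbhs.
by apply: filterS.
Qed.

Lemma Ck_continuous k D f p : Ck k D f -> D p -> {for p, continuous f}.
Proof. by case: k => [|k] [H _] /H. Qed.

Lemma Ck_derivable k D f p v : Ck k.+1 D f -> D p -> derivable f p v.
Proof. by move=> [_ /(_ v) [H _]] /H. Qed.

Lemma Ck_derive k D f v : Ck k.+1 D f -> Ck k D ('D_v f).
Proof. by move=> [_ /(_ v) []]. Qed.

Lemma Ck_pred k D f : Ck k.+1 D f -> Ck k D f.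
Proof.
elim: k f => [|k IH] f [H K]; first by split.
by split=> // v; have [K1 K2] := K v; split=> //; apply: IH.
Qed.

Lemma eq_on_derive D f g p v : open D -> D p -> (forall q, D q -> f q = g q) ->
  'D_v f p = 'D_v g p.
Proof. by move=> oD Dp fg; apply: near_eq_derive; exact: near_open oD Dp fg. Qed.

Lemma eq_on_continuous D f g p : open D -> D p -> (forall q, D q -> f q = g q) ->
  {for p, continuous f} -> {for p, continuous g}.
Proof.
move=> oD Dp fg cf; have cf' : f x @[x --> p] --> f p := cf.
suff : g x @[x --> p] --> g p by [].
rewrite -(fg _ Dp); apply: cvg_trans cf'; apply: near_eq_cvg.
exact: near_open oD Dp fg.
Qed.

(** The rules for derivatives of sums and products hold only on [D], where derivability is known;
    this lemma lets the inductions on [k] below pass through them. *)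
Lemma eq_on_Ck k D f g : open D -> (forall q, D q -> f q = g q) ->
  Ck k D f -> Ck k D g.
Proof.
move=> oD; elim: k f g => [|k IH] f g fg [H K].
  by split=> // p Dp; apply: eq_on_continuous oD Dp fg (H p Dp).
split=> [p Dp|v]; first by apply: eq_on_continuous oD Dp fg (H p Dp).
have [K1 K2] := K v; split=> [p Dp|].
  by apply: near_eq_derivable (K1 _ Dp); exact: near_open oD Dp fg.
by apply: IH K2 => q Dq; exact: eq_on_derive oD Dq fg.
Qed.

Lemma Ck_cst k D (a : R) : Ck k D (fun=> a).
Proof.
elim: k a => [|k IH] a; (split; first by move=> p _; exact: cvg_cst) => //.
move=> v; split=> [p _|]; first exact: derivable_cst.
suff -> : 'D_v (fun=> a) = (fun=> 0) :> (V -> R) by [].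
by apply/funext => p; exact: derive_cst.
Qed.

Lemma CkD k D f g : open D -> Ck k D f -> Ck k D g -> Ck k D (fun q => f q + g q).
Proof.
move=> oD; elim: k f g => [|k IH] f g [cf df] [cg dg].
  by split=> // p Dp; apply: cvgD; [exact: cf|exact: cg].
split=> [p Dp|v]; first by apply: cvgD; [exact: cf|exact: cg].
have [df1 df2] := df v; have [dg1 dg2] := dg v; split=> [p Dp|].
  by apply: derivableD; [exact: df1|exact: dg1].
apply: eq_on_Ck oD _ (IH _ _ df2 dg2) => q Dq.
by rewrite deriveD //; [exact: df1|exact: dg1].
Qed.

Lemma CkM k D f g : open D -> Ck k D f -> Ck k D g -> Ck k D (fun q => f q * g q).
Proof.
move=> oD; elim: k f g => [|k IH] f g cf cg.
  case: cf cg => [cf df] [cg dg].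
  by split=> // p Dp; apply: cvgM; [exact: cf|exact: cg].
split=> [p Dp|v]; first by apply: cvgM; [exact: Ck_continuous cf Dp|exact: Ck_continuous cg Dp].
split=> [p Dp|].
  by apply: derivableM; [exact: Ck_derivable cf Dp|exact: Ck_derivable cg Dp].
(* In the Leibniz formula each derivative has class [k], so the other factor is lowered from [k.+1]
   to [k]. *)
have K1 := IH _ _ (Ck_pred _ _ _ cf) (Ck_derive _ _ _ v cg).
have K2 := IH _ _ (Ck_pred _ _ _ cg) (Ck_derive _ _ _ v cf).
apply: eq_on_Ck oD _ (CkD _ _ _ _ oD K1 K2) => q Dq.
by rewrite deriveM //; [exact: Ck_derivable cf Dq|exact: Ck_derivable cg Dq].
Qed.

Lemma CkN k D f : open D -> Ck k D f -> Ck k D (fun q => - f q).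
Proof.
move=> oD /(CkM _ _ _ _ oD (Ck_cst k D (-1))).
by apply: eq_on_Ck => // q _; rewrite mulN1r.
Qed.

Lemma CkB k D f g : open D -> Ck k D f -> Ck k D g -> Ck k D (fun q => f q - g q).
Proof. by move=> oD cf cg; apply: CkD => //; exact: CkN. Qed.

Lemma Ck_sum k D (I : finType) (F : I -> V -> R) : open D ->
  (forall i, Ck k D (F i)) -> Ck k D (fun q => \sum_i F i q).
Proof.
move=> oD cF.
have : forall s : seq I, Ck k D (fun q => \sum_(i <- s) F i q).
  elim=> [|i s IH].
    by apply: eq_on_Ck oD _ (Ck_cst k D 0) => q _; rewrite big_nil.
  by apply: eq_on_Ck oD _ (CkD _ _ _ _ oD (cF i) IH) => q _; rewrite big_cons.
exact.
Qed.

Lemma Ck_derive_symmetric D f p v w : open D -> D p -> Ck 2 D f ->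
  'D_w ('D_v f) p = 'D_v ('D_w f) p.
Proof.
move=> oD Dp cf; apply: (derive_symmetric D) => // [q Dq|q Dq|q Dq|q Dq||].
- exact: Ck_derivable cf Dq.
- exact: Ck_derivable cf Dq.
- exact: Ck_derivable (Ck_derive _ _ _ v cf) Dq.
- exact: Ck_derivable (Ck_derive _ _ _ w cf) Dq.
- exact: Ck_continuous (Ck_derive _ _ _ w (Ck_derive _ _ _ v cf)) Dp.
- exact: Ck_continuous (Ck_derive _ _ _ v (Ck_derive _ _ _ w cf)) Dp.
Qed.

End ContinuouslyDerivable.

(** * Two-by-two matrices and the algebraic identity behind the curvature formula *)

Section PlaneMetrics.
Context {R : realType}.

Lemma sum_I2 (F : 'I_2 -> R) : \sum_(i < 2) F i = F 0 + F 1.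
Proof. by rewrite big_ord_recl big_ord1; congr (_ + F _); exact: val_inj. Qed.

Lemma det_mx22 (M : 'M[R]_2) : \det M = M 0 0 * M 1 1 - M 0 1 * M 1 0.
Proof.
rewrite (expand_det_row M 0) sum_I2 /cofactor !det_mx11 !mxE /= addn0 expr0 expr1.
rewrite (_ : lift 0 0 = 1); last exact: val_inj.
rewrite (_ : lift 1 0 = 0); last exact: val_inj.
by ring.
Qed.

Lemma invmx_mx22 (M : 'M[R]_2) : \det M != 0 ->
  [/\ invmx M 0 0 = M 1 1 / \det M, invmx M 0 1 = - M 0 1 / \det M,
      invmx M 1 0 = - M 1 0 / \det M & invmx M 1 1 = M 0 0 / \det M].
Proof.
move=> d0; rewrite /invmx unitmxE unitfE d0 !mxE /cofactor !det_mx11 !mxE /=.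
rewrite (_ : lift 0 0 = 1); last exact: val_inj.
rewrite (_ : lift 1 0 = 0); last exact: val_inj.
by split; rewrite ?addn0 ?add0n /= ?addn1 ?expr0 ?expr1 ?sqrrN ?expr1n; ring.
Qed.

(** The left side is the Gauss equation of a Chebyshev net, the right side the expanded derivative
    of the stated quotient. Here [s] is the root of the determinant, [G0] and [G1] are Gamma^0_{11}
    and Gamma^1_{11}, and [x], [y] are their derivatives along [e 0]. *)
Lemma chebyshev_net_algebra (E F G EL FL FR GR FLR x y s d G0 G1 : R) :
  E != 0 -> s != 0 -> s ^+ 2 = d -> d = E * G - F ^+ 2 ->
  G0 = (G * FR - 2^-1 * F * GR) / d -> G1 = (2^-1 * E * GR - F * FR) / d ->
  E * x + EL * G0 + (F * y + FL * G1) = FLR ->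
  (E * (x + (2^-1 * G * EL - F * FL) / d * G0)
   + F * (y + (E * FL - 2^-1 * F * EL) / d * G0)) / d =
  s^-1 * (((FLR - 2^-1 * FR * (EL / E)) * s
    - (FL - 2^-1 * F * (EL / E)) * ((2 * s)^-1 * (E * GR - 2 * F * FR))) / s ^+ 2).
Proof.
move=> E0 s0 sd dE.
(* Eliminating [G] leaves a rational identity with denominators [E] and [s] only; [x] and [y] cancel
   once [FLR] is replaced by the last hypothesis. *)
have -> : G = (s ^+ 2 + F ^+ 2) / E by rewrite sd dE; field.
rewrite -sd => -> -> <-.
by field; rewrite E0 s0.
Qed.

End PlaneMetrics.

(** * Gaussian curvature of a metric whose coordinates form a Chebyshev net *)

Section ChebyshevNet.
Context {R : realType} (D : set (R * R)) (e : 'I_2 -> R * R) (g : R * R -> 'M[R]_2).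
Context (E F G : R * R -> R).
Hypothesis g00 : forall q, g q 0 0 = E q.
Hypothesis g01 : forall q, g q 0 1 = F q.
Hypothesis g10 : forall q, g q 1 0 = F q.
Hypothesis g11 : forall q, g q 1 1 = G q.
Hypothesis oD : open D.
Hypothesis CE : Ck 2 D E.
Hypothesis CF : Ck 2 D F.
Hypothesis CG : Ck 2 D G.
Hypothesis E_pos : forall q, D q -> 0 < E q.
Hypothesis det_pos : forall q, D q -> 0 < E q * G q - F q ^+ 2.
Hypothesis d1_E : forall q, D q -> 'D_(e 1) E q = 0.
Hypothesis d0_G : forall q, D q -> 'D_(e 0) G q = 0.

Let d q := E q * G q - F q ^+ 2.

Let d_neq0 q : D q -> d q != 0.
Proof. by move=> Dq; rewrite gt_eqF // det_pos. Qed.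

Let detE q : \det (g q) = d q.
Proof. by rewrite det_mx22 g00 g01 g10 g11 /d expr2. Qed.

Let g00E : (fun q => g q 0 0) = E. Proof. exact/funext. Qed.
Let g01E : (fun q => g q 0 1) = F. Proof. exact/funext. Qed.
Let g10E : (fun q => g q 1 0) = F. Proof. exact/funext. Qed.
Let g11E : (fun q => g q 1 1) = G. Proof. exact/funext. Qed.
Let gE := (g00E, g01E, g10E, g11E).

(* Twice the Christoffel symbol of the first kind, with the index b lowered. *)
Let br i j b q : R :=
  'D_(e i) (fun q => g q b j) q + 'D_(e j) (fun q => g q b i) q
  - 'D_(e b) (fun q => g q i j) q.

Let christoffelE a i j q : christoffel e g a i j q =
  2^-1 * (invmx (g q) a 0 * br i j 0 q + invmx (g q) a 1 * br i j 1 q).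
Proof. by rewrite /christoffel sum_I2. Qed.

Let christoffel0 i j q : D q -> christoffel e g 0 i j q =
  (2 * d q)^-1 * (G q * br i j 0 q - F q * br i j 1 q).
Proof.
move=> /d_neq0 d0; have := invmx_mx22 (g q); rewrite detE => /(_ d0) [i00 i01 _ _].
rewrite christoffelE i00 i01 g11 g01; move: (br _ _ _ _) (br _ _ _ _) => a b.
by field.
Qed.

Let christoffel1 i j q : D q -> christoffel e g 1 i j q =
  (2 * d q)^-1 * (E q * br i j 1 q - F q * br i j 0 q).
Proof.
move=> /d_neq0 d0; have := invmx_mx22 (g q); rewrite detE => /(_ d0) [_ _ i10 i11].
rewrite christoffelE i10 i11 g00 g10; move: (br _ _ _ _) (br _ _ _ _) => a b.
by field.
Qed.

Let br010 q : D q -> br 0 1 0 q = 0.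
Proof. by move=> Dq; rewrite /br !gE d1_E // addr0 subrr. Qed.

Let br011 q : D q -> br 0 1 1 q = 0.
Proof. by move=> Dq; rewrite /br !gE d0_G // add0r subrr. Qed.

Let br110 q : D q -> br 1 1 0 q = 2 * 'D_(e 1) F q.
Proof. by move=> Dq; rewrite /br !gE d0_G // subr0 mulr_natl mulr2n. Qed.

Let br111 q : br 1 1 1 q = 'D_(e 1) G q.
Proof. by rewrite /br !gE addrK. Qed.

Let br000 q : br 0 0 0 q = 'D_(e 0) E q.
Proof. by rewrite /br !gE addrK. Qed.

Let br001 q : D q -> br 0 0 1 q = 2 * 'D_(e 0) F q.
Proof. by move=> Dq; rewrite /br !gE d1_E // subr0 mulr_natl mulr2n. Qed.

(** Both symbols of the first kind reduce to derivatives of [E] along [e 1] and of [G] along [e 0],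
    which vanish. *)
Let christoffel_01 q a : D q -> christoffel e g a 0 1 q = 0.
Proof.
move=> Dq; have [-> | ->] : a = 0 \/ a = 1.
- by case: a => [[|[|//]] ?]; [left|right]; exact: val_inj.
- by rewrite christoffel0 // br010 // br011 // !mulr0 subrr mulr0.
by rewrite christoffel1 // br010 // br011 // !mulr0 subrr mulr0.
Qed.

(** Closed forms, on [D], of Gamma^0_{11} and, in [G1], of Gamma^1_{11}. *)
Let G0 q := (G q * 'D_(e 1) F q - 2^-1 * F q * 'D_(e 1) G q) / d q.
Let G1 q := (2^-1 * E q * 'D_(e 1) G q - F q * 'D_(e 1) F q) / d q.

Let christoffel_011 q : D q -> christoffel e g 0 1 1 q = G0 q.
Proof.
move=> Dq; rewrite christoffel0 // br110 // br111 /G0; move: (d_neq0 _ Dq) => d0.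
by move: ('D_(e 1) F q) ('D_(e 1) G q) => x y; field.
Qed.

Let christoffel_111 q : D q -> christoffel e g 1 1 1 q = G1 q.
Proof.
move=> Dq; rewrite christoffel1 // br110 // br111 /G1; move: (d_neq0 _ Dq) => d0.
by move: ('D_(e 1) F q) ('D_(e 1) G q) => x y; field.
Qed.

Let christoffel_000 q : D q -> christoffel e g 0 0 0 q =
  (2^-1 * G q * 'D_(e 0) E q - F q * 'D_(e 0) F q) / d q.
Proof.
move=> Dq; rewrite christoffel0 // br000 br001 //; move: (d_neq0 _ Dq) => d0.
by move: ('D_(e 0) F q) ('D_(e 0) E q) => x y; field.
Qed.

Let christoffel_100 q : D q -> christoffel e g 1 0 0 q =
  (E q * 'D_(e 0) F q - 2^-1 * F q * 'D_(e 0) E q) / d q.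
Proof.
move=> Dq; rewrite christoffel1 // br000 br001 //; move: (d_neq0 _ Dq) => d0.
by move: ('D_(e 0) F q) ('D_(e 0) E q) => x y; field.
Qed.

Let Cd : Ck 2 D d.
Proof. exact: (CkB _ _ _ _ oD (CkM _ _ _ _ oD CE CG) (CkM _ _ _ _ oD CF CF)). Qed.

Let derivable_div (h : R * R -> R) q v : D q -> Ck 1 D h ->
  derivable (fun q => h q / d q) q v.
Proof.
move=> Dq Ch; apply: derivableM; first exact: (Ck_derivable _ _ _ _ _ Ch Dq).
by apply: derivableV; [exact: d_neq0|exact: (Ck_derivable _ _ _ _ _ Cd Dq)].
Qed.

Let C1E : Ck 1 D E := Ck_pred _ _ _ CE.
Let C1F : Ck 1 D F := Ck_pred _ _ _ CF.
Let C1G : Ck 1 D G := Ck_pred _ _ _ CG.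
Let half_M h : Ck 1 D h -> Ck 1 D (fun q => 2^-1 * h q) :=
  fun Ch => CkM _ _ _ _ oD (Ck_cst 1 D 2^-1) Ch.

(** Existence alone is wanted: the product rule in [derive_lower_G] requires it, while the value is
    never expanded. *)
Let derivable_G0 q v : D q -> derivable G0 q v.
Proof.
move=> Dq; apply: (derivable_div _ _ _ Dq); apply: (CkB _ _ _ _ oD).
  exact: (CkM _ _ _ _ oD C1G (Ck_derive _ _ _ _ CF)).
exact: (CkM _ _ _ _ oD (half_M _ C1F) (Ck_derive _ _ _ _ CG)).
Qed.

Let derivable_G1 q v : D q -> derivable G1 q v.
Proof.
move=> Dq; apply: (derivable_div _ _ _ Dq); apply: (CkB _ _ _ _ oD).
  exact: (CkM _ _ _ _ oD (half_M _ C1E) (Ck_derive _ _ _ _ CG)).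
exact: (CkM _ _ _ _ oD C1F (Ck_derive _ _ _ _ CF)).
Qed.

(* Lowering the index of Gamma^a_{11} avoids differentiating the quotients G0
   and G1: their derivatives enter the curvature only through this combination. *)
Let lower_G q : D q -> E q * G0 q + F q * G1 q = 'D_(e 1) F q.
Proof.
move=> /d_neq0; rewrite /G0 /G1 /d.
by move: ('D_(e 1) F q) ('D_(e 1) G q) => x y d0; field.
Qed.

(** Product rule applied to [lower_G]; it is the last hypothesis of [chebyshev_net_algebra]. *)
Let derive_lower_G q v : D q ->
  E q * 'D_v G0 q + 'D_v E q * G0 q + (F q * 'D_v G1 q + 'D_v F q * G1 q) =
  'D_v ('D_(e 1) F) q.
Proof.
move=> Dq.
have dE := derivableP (Ck_derivable _ _ _ _ v CE Dq).
have dF := derivableP (Ck_derivable _ _ _ _ v CF Dq).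
have dG0 := derivableP (derivable_G0 _ v Dq).
have dG1 := derivableP (derivable_G1 _ v Dq).
have H := is_deriveD (is_deriveM dE dG0) (is_deriveM dF dG1).
have -> : 'D_v ('D_(e 1) F) q = 'D_v (E * G0 + F * G1) q.
  by apply: (eq_on_derive D) => // q' Dq'; rewrite -lower_G.
move: (@derive_val _ _ _ _ _ _ _ H) => ->; rewrite -![_ *: _]/(_ * _).
move: ('D_v E q) ('D_v F q) ('D_v G0 q) ('D_v G1 q) => x y z t.
by ring.
Qed.

(** The mixed symbols vanish on all of [D], hence so do their derivative and every quadratic term
    containing one; only Gamma^0_{00} Gamma^0_{11} survives in the sum. *)
Let riemann0 p : D p -> riemann e g 0 1 0 1 p =
  'D_(e 0) G0 p + christoffel e g 0 0 0 p * G0 p.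
Proof.
move=> Dp; rewrite /riemann sum_I2 !(christoffel_01 _ _ Dp) (christoffel_011 _ Dp).
rewrite (eq_on_derive _ _ _ _ (e 0) oD Dp christoffel_011).
rewrite (eq_on_derive _ _ _ _ (e 1) oD Dp (fun q Dq => christoffel_01 q 0 Dq)) derive_cst.
by rewrite !mulr0 mul0r !subr0 addr0.
Qed.

Let riemann1 p : D p -> riemann e g 1 1 0 1 p =
  'D_(e 0) G1 p + christoffel e g 1 0 0 p * G0 p.
Proof.
move=> Dp; rewrite /riemann sum_I2 !(christoffel_01 _ _ Dp) (christoffel_011 _ Dp).
rewrite (eq_on_derive _ _ _ _ (e 0) oD Dp christoffel_111).
rewrite (eq_on_derive _ _ _ _ (e 1) oD Dp (fun q Dq => christoffel_01 q 1 Dq)) derive_cst.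
by rewrite !mulr0 mul0r !subr0 addr0.
Qed.

Let derive_ln_E q : D q -> 'D_(e 0) (fun q => ln (E q)) q = 'D_(e 0) E q / E q.
Proof.
move=> Dq; have dE := derivableP (Ck_derivable _ _ _ _ (e 0) CE Dq).
have H := is_derive_comp_line _ _ _ _ _ _ dE (is_derive1_ln (E_pos _ Dq)).
by rewrite (@derive_val _ _ _ _ _ _ _ H) mulrC.
Qed.

Lemma chebyshev_net_curvature p : D p ->
  gaussian_curvature e g p =
  (Num.sqrt (d p))^-1 *
  'D_(e 1) (fun q => ('D_(e 0) F q - 2^-1 * F q * 'D_(e 0) (fun q => ln (E q)) q)
                     / Num.sqrt (d q)) p.
Proof.
move=> Dp; have dp := det_pos _ Dp; rewrite -/(d p) in dp.
have s0 : 0 < Num.sqrt (d p) by rewrite sqrtr_gt0.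
have E0 := E_pos _ Dp.
(* The logarithmic derivative is replaced on all of [D], not only at [p], because the quotient is
   differentiated once more. *)
pose h q := ('D_(e 0) F q - 2^-1 * F q * ('D_(e 0) E q / E q)) / Num.sqrt (d q).
rewrite (eq_on_derive D _ h _ (e 1) oD Dp); last first.
  by move=> q Dq; rewrite /h derive_ln_E.
have dE := derivableP (Ck_derivable _ _ _ _ (e 1) CE Dp); rewrite d1_E // in dE.
have dF := derivableP (Ck_derivable _ _ _ _ (e 1) CF Dp).
have dG := derivableP (Ck_derivable _ _ _ _ (e 1) CG Dp).
have dEL := derivableP (Ck_derivable _ _ _ _ (e 1) (Ck_derive _ _ _ (e 0) CE) Dp).
have dFL := derivableP (Ck_derivable _ _ _ _ (e 1) (Ck_derive _ _ _ (e 0) CF) Dp).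
(* Exchanging the derivatives brings that of [F] into the form of [derive_lower_G] and makes that of
   [E] vanish, since ['D_(e 1) E] is zero on [D]. *)
rewrite (Ck_derive_symmetric D _ _ _ _ oD Dp CF) in dFL.
rewrite (Ck_derive_symmetric D _ _ _ _ oD Dp CE) in dEL.
rewrite (eq_on_derive _ _ _ _ (e 0) oD Dp d1_E) derive_cst in dEL.
pose FR := 'D_(e 1) F p; pose GR := 'D_(e 1) G p.
pose EL := 'D_(e 0) E p; pose FL := 'D_(e 0) F p.
pose FLR := 'D_(e 0) ('D_(e 1) F) p.
have dd : is_derive p (e 1) d (E p * GR - 2 * F p * FR).
  apply: is_derive_eq (is_deriveB (is_deriveM dE dG) (is_deriveM dF dF)) _.
  by rewrite -![_ *: _]/(_ * _) -/FR -/GR; ring.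
have ds := is_derive_comp_line _ _ _ _ _ _ dd (is_derive1_sqrt dp).
have dq : is_derive p (e 1) (fun q => 'D_(e 0) E q / E q) 0.
  apply: is_derive_eq (is_derive_div _ _ _ _ _ _ (lt0r_neq0 E0) dEL dE) _.
  by rewrite mul0r mulr0 subrr mul0r.
have dF2 : is_derive p (e 1) (fun q => 2^-1 * F q) (2^-1 * FR).
  apply: is_derive_eq (is_deriveM (is_derive_cst (2^-1 : R) p (e 1)) dF) _.
  by rewrite scaler0 addr0.
have dn : is_derive p (e 1)
    (fun q => 'D_(e 0) F q - 2^-1 * F q * ('D_(e 0) E q / E q))
    (FLR - 2^-1 * FR * (EL / E p)).
  apply: is_derive_eq (is_deriveB dFL (is_deriveM dF2 dq)) _.
  by rewrite scaler0 add0r -[_ *: _]/(_ * _) -/EL -/FLR; ring.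
have dh := is_derive_div _ (fun q => Num.sqrt (d q)) _ _ _ _ (lt0r_neq0 s0) dn ds.
move: (@derive_val _ _ _ _ _ _ _ dh) => ->.
rewrite /gaussian_curvature sum_I2 riemann0 // riemann1 // christoffel_000 //.
rewrite christoffel_100 // g00 g01 detE.
apply: (chebyshev_net_algebra _ _ (G p) _ _ FR GR FLR _ _ _ _ _ (G1 p)) => //.
- exact: lt0r_neq0.
- exact: lt0r_neq0.
- by rewrite sqr_sqrtr // ltW.
- exact: (derive_lower_G p (e 0) Dp).
Qed.

End ChebyshevNet.

(** * Calculus of complex matrix functions and the scalar product on su(N) *)

Section ComplexMatrixFunctions.
Set Implicit Arguments.
Unset Strict Implicit.
Context {R : realType}.
Local Notation V := (R * R)%type.
Local Notation derive_mx := Defs.derive_mx.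
Implicit Types (D : set V) (p v w : V).

Lemma smooth_on_Ck k D (f : V -> R) : smooth_on D f -> Ck k D f.
Proof.
elim: k f => [|k IH] f sf.
  by split=> // p Dp; apply: differentiable_continuous; exact: (sf [::] p Dp).
split=> [p Dp|v]; first by apply: differentiable_continuous; exact: (sf [::] p Dp).
split=> [p Dp|]; first by apply: diff_derivable; exact: (sf [::] p Dp).
(* [foldr] applies the last vector first, so iterated derivatives of ['D_v f] are those of [f] along
   lists ending in [v]. *)
by apply: IH => vs p Dp; have := sf (rcons vs v) p Dp; rewrite foldr_rcons.
Qed.

Lemma ReM (x y : R[i]) :
  complex.Re (x * y) = complex.Re x * complex.Re y - complex.Im x * complex.Im y.
Proof. by case: x; case: y. Qed.

Lemma ImM (x y : R[i]) :
  complex.Im (x * y) = complex.Re x * complex.Im y + complex.Im x * complex.Re y.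
Proof. by case: x => a b; case: y. Qed.

Lemma ReD (x y : R[i]) : complex.Re (x + y) = complex.Re x + complex.Re y.
Proof. by case: x; case: y. Qed.

Lemma ImD (x y : R[i]) : complex.Im (x + y) = complex.Im x + complex.Im y.
Proof. by case: x; case: y. Qed.

Lemma ReN (x : R[i]) : complex.Re (- x) = - complex.Re x.
Proof. by case: x. Qed.

Lemma ImN (x : R[i]) : complex.Im (- x) = - complex.Im x.
Proof. by case: x. Qed.

Lemma Re_conj (x : R[i]) : complex.Re (Num.conj x) = complex.Re x.
Proof. by case: x. Qed.

Lemma Im_conj (x : R[i]) : complex.Im (Num.conj x) = - complex.Im x.
Proof. by case: x. Qed.

Lemma Re_sum (I : finType) (F : I -> R[i]) :
  complex.Re (\sum_i F i) = \sum_i complex.Re (F i).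
Proof. by apply: (big_morph _ ReD). Qed.

Lemma Im_sum (I : finType) (F : I -> R[i]) :
  complex.Im (\sum_i F i) = \sum_i complex.Im (F i).
Proof. by apply: (big_morph _ ImD). Qed.

(** A relational companion of [derive_mx] that records existence together with the value, so that
    rules can be chained before [derive_mx_val] reads off the result. *)
Definition is_derive_mx k l p v (A : V -> 'M[R[i]]_(k, l)) (dA : 'M[R[i]]_(k, l)) :=
  forall i j, is_derive p v (fun q => complex.Re (A q i j)) (complex.Re (dA i j)) /\
              is_derive p v (fun q => complex.Im (A q i j)) (complex.Im (dA i j)).

Definition Ck_mx k l c D (A : V -> 'M[R[i]]_(k, l)) :=
  forall i j, Ck c D (fun q => complex.Re (A q i j)) /\
              Ck c D (fun q => complex.Im (A q i j)).

Lemma smooth_mx_Ck k l c D (A : V -> 'M[R[i]]_(k, l)) : smooth_mx D A -> Ck_mx c D A.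
Proof. by move=> sA i j; have [? ?] := sA i j; split; exact: smooth_on_Ck. Qed.

Lemma derive_mx_val k l p v (A : V -> 'M[R[i]]_(k, l)) dA :
  is_derive_mx p v A dA -> derive_mx v A p = dA.
Proof.
move=> H; apply/matrixP => i j; rewrite mxE; have [H1 H2] := H i j.
by rewrite (@derive_val _ _ _ _ _ _ _ H1) (@derive_val _ _ _ _ _ _ _ H2); case: (dA i j).
Qed.

Lemma Ck_mx_derive k l c D v (A : V -> 'M[R[i]]_(k, l)) :
  Ck_mx c.+1 D A -> Ck_mx c D (derive_mx v A).
Proof.
move=> CA i j; have [C1 C2] := CA i j; split.
  rewrite (_ : (fun q => _) = 'D_v (fun q => complex.Re (A q i j))).
    exact: (Ck_derive _ _ _ v C1).
  by apply/funext => q; rewrite mxE.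
rewrite (_ : (fun q => _) = 'D_v (fun q => complex.Im (A q i j))).
  exact: (Ck_derive _ _ _ v C2).
by apply/funext => q; rewrite mxE.
Qed.

Lemma Ck_mx_is_derive k l c D p v (A : V -> 'M[R[i]]_(k, l)) :
  Ck_mx c.+1 D A -> D p -> is_derive_mx p v A (derive_mx v A p).
Proof.
move=> CA Dp i j; have [C1 C2] := CA i j; rewrite mxE /=.
by split; apply: derivableP;
  [exact: (Ck_derivable _ _ _ _ v C1 Dp)|exact: (Ck_derivable _ _ _ _ v C2 Dp)].
Qed.

Lemma eq_on_derive_mx k l D p v (A B : V -> 'M[R[i]]_(k, l)) : open D -> D p ->
  (forall q, D q -> A q = B q) -> derive_mx v A p = derive_mx v B p.
Proof.
move=> oD Dp AB; apply/matrixP => i j; rewrite !mxE.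
by congr (_ +i* _); apply: (eq_on_derive D _ _ _ v oD Dp) => q Dq; rewrite AB.
Qed.

Lemma derive_mx_symmetric k l D p v w (A : V -> 'M[R[i]]_(k, l)) :
  open D -> D p -> Ck_mx 2 D A ->
  derive_mx w (derive_mx v A) p = derive_mx v (derive_mx w A) p.
Proof.
move=> oD Dp CA; apply/matrixP => i j; have [C1 C2] := CA i j.
have E1 u : (fun q => complex.Re (derive_mx u A q i j)) =
    'D_u (fun q => complex.Re (A q i j)) by apply/funext => q; rewrite mxE.
have E2 u : (fun q => complex.Im (derive_mx u A q i j)) =
    'D_u (fun q => complex.Im (A q i j)) by apply/funext => q; rewrite mxE.
rewrite [LHS]mxE [RHS]mxE (E1 v) (E2 v) (E1 w) (E2 w).
exact: (congr2 (@Complex R) (Ck_derive_symmetric D _ _ v w oD Dp C1)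
                            (Ck_derive_symmetric D _ _ v w oD Dp C2)).
Qed.

Lemma is_derive_mxD k l p v (A B : V -> 'M[R[i]]_(k, l)) dA dB :
  is_derive_mx p v A dA -> is_derive_mx p v B dB ->
  is_derive_mx p v (fun q => A q + B q) (dA + dB).
Proof.
move=> HA HB i j; have [HA1 HA2] := HA i j; have [HB1 HB2] := HB i j.
rewrite mxE ReD ImD; split.
  rewrite (_ : (fun q => _) = (fun q => complex.Re (A q i j)) + (fun q => complex.Re (B q i j))).
    exact: is_deriveD.
  by apply/funext => q; rewrite mxE ReD.
rewrite (_ : (fun q => _) = (fun q => complex.Im (A q i j)) + (fun q => complex.Im (B q i j))).
  exact: is_deriveD.
by apply/funext => q; rewrite mxE ImD.
Qed.

Lemma is_derive_mxN k l p v (A : V -> 'M[R[i]]_(k, l)) dA :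
  is_derive_mx p v A dA -> is_derive_mx p v (fun q => - A q) (- dA).
Proof.
move=> HA i j; have [HA1 HA2] := HA i j; rewrite mxE ReN ImN; split.
  rewrite (_ : (fun q => _) = - (fun q => complex.Re (A q i j))).
    exact: is_deriveN.
  by apply/funext => q; rewrite mxE ReN.
rewrite (_ : (fun q => _) = - (fun q => complex.Im (A q i j))).
  exact: is_deriveN.
by apply/funext => q; rewrite mxE ImN.
Qed.

Lemma is_derive_mxM k l r p v (A : V -> 'M[R[i]]_(k, l)) (B : V -> 'M[R[i]]_(l, r)) dA dB :
  is_derive_mx p v A dA -> is_derive_mx p v B dB ->
  is_derive_mx p v (fun q => A q *m B q) (dA *m B p + A p *m dB).
Proof.
move=> HA HB i j.
pose reA s q := complex.Re (A q i s); pose imA s q := complex.Im (A q i s).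
pose reB s q := complex.Re (B q s j); pose imB s q := complex.Im (B q s j).
pose C := dA *m B p + A p *m dB; rewrite -/C.
have HRe s : is_derive p v (reA s * reB s - imA s * imB s)
    (complex.Re (dA i s * B p s j + A p i s * dB s j)).
  have [HA1 HA2] := HA i s; have [HB1 HB2] := HB s j.
  apply: is_derive_eq (is_deriveB (is_deriveM HA1 HB1) (is_deriveM HA2 HB2)) _.
  rewrite ReD !ReM -![_ *: _]/(_ * _).
  move: (complex.Re _) (complex.Im _) (complex.Re _) (complex.Im _) => a b c d.
  by move: (complex.Re _) (complex.Im _) (complex.Re _) (complex.Im _) => *; ring.
have HIm s : is_derive p v (reA s * imB s + imA s * reB s)
    (complex.Im (dA i s * B p s j + A p i s * dB s j)).
  have [HA1 HA2] := HA i s; have [HB1 HB2] := HB s j.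
  apply: is_derive_eq (is_deriveD (is_deriveM HA1 HB2) (is_deriveM HA2 HB1)) _.
  rewrite ImD !ImM -![_ *: _]/(_ * _).
  move: (complex.Re _) (complex.Im _) (complex.Re _) (complex.Im _) => a b c d.
  by move: (complex.Re _) (complex.Im _) (complex.Re _) (complex.Im _) => *; ring.
have CE : C i j = \sum_s (dA i s * B p s j + A p i s * dB s j).
  by rewrite /C !mxE big_split.
rewrite CE Re_sum Im_sum; split.
  have -> : (fun q => complex.Re ((A q *m B q) i j)) =
      \sum_(s < l) (reA s * reB s - imA s * imB s).
    by apply/funext => q; rewrite mxE Re_sum fct_sumE; apply: eq_bigr => s _; rewrite ReM.
  exact: (@is_derive_sum _ _ _ _ _ _ _ _ HRe).
have -> : (fun q => complex.Im ((A q *m B q) i j)) =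
    \sum_(s < l) (reA s * imB s + imA s * reB s).
  by apply/funext => q; rewrite mxE Im_sum fct_sumE; apply: eq_bigr => s _; rewrite ImM.
exact: (@is_derive_sum _ _ _ _ _ _ _ _ HIm).
Qed.

Lemma is_derive_mx_commutator N p v (A B : V -> 'M[R[i]]_N) dA dB :
  is_derive_mx p v A dA -> is_derive_mx p v B dB ->
  is_derive_mx p v (fun q => commutator_mx (A q) (B q))
    (commutator_mx dA (B p) + commutator_mx (A p) dB).
Proof.
move=> HA HB.
(* Regrouped as the derivative of A B minus that of B A. *)
have -> : commutator_mx dA (B p) + commutator_mx (A p) dB =
    (dA *m B p + A p *m dB) + - (dB *m A p + B p *m dA).
  by rewrite /commutator_mx opprD addrACA [- (B p *m dA) + _]addrC.
by apply: is_derive_mxD; [exact: is_derive_mxM|apply: is_derive_mxN; exact: is_derive_mxM].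
Qed.

Local Open Scope sesquilinear_scope.

Lemma is_derive_mx_adjoint k l p v (A : V -> 'M[R[i]]_(k, l)) dA :
  is_derive_mx p v A dA -> is_derive_mx p v (fun q => (A q) ^t*) (dA ^t*).
Proof.
move=> HA i j; have [HA1 HA2] := HA j i; rewrite !mxE Re_conj Im_conj; split.
  rewrite (_ : (fun q => _) = (fun q => complex.Re (A q j i))) //.
  by apply/funext => q; rewrite !mxE Re_conj.
rewrite (_ : (fun q => _) = - (fun q => complex.Im (A q j i))).
  exact: is_deriveN.
by apply/funext => q; rewrite !mxE Im_conj.
Qed.

Lemma Ck_mxN k l c D (A : V -> 'M[R[i]]_(k, l)) : open D -> Ck_mx c D A ->
  Ck_mx c D (fun q => - A q).
Proof.
move=> oD CA i j; have [C1 C2] := CA i j; split.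
  rewrite (_ : (fun q => _) = (fun q => - complex.Re (A q i j))).
    exact: (CkN _ _ _ oD C1).
  by apply/funext => q; rewrite mxE ReN.
rewrite (_ : (fun q => _) = (fun q => - complex.Im (A q i j))).
  exact: (CkN _ _ _ oD C2).
by apply/funext => q; rewrite mxE ImN.
Qed.

Lemma Ck_mxD k l c D (A B : V -> 'M[R[i]]_(k, l)) : open D ->
  Ck_mx c D A -> Ck_mx c D B -> Ck_mx c D (fun q => A q + B q).
Proof.
move=> oD CA CB i j; have [A1 A2] := CA i j; have [B1 B2] := CB i j; split.
  rewrite (_ : (fun q => _) = (fun q => complex.Re (A q i j) + complex.Re (B q i j))).
    exact: (CkD _ _ _ _ oD A1 B1).
  by apply/funext => q; rewrite mxE ReD.
rewrite (_ : (fun q => _) = (fun q => complex.Im (A q i j) + complex.Im (B q i j))).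
  exact: (CkD _ _ _ _ oD A2 B2).
by apply/funext => q; rewrite mxE ImD.
Qed.

Lemma Ck_mx_cst k l c D (A : 'M[R[i]]_(k, l)) : Ck_mx c D (fun=> A).
Proof. by move=> i j; split; exact: Ck_cst. Qed.

Lemma Ck_mx_adjoint k l c D (A : V -> 'M[R[i]]_(k, l)) : open D ->
  Ck_mx c D A -> Ck_mx c D (fun q => (A q) ^t*).
Proof.
move=> oD CA i j; have [C1 C2] := CA j i; split.
  rewrite (_ : (fun q => _) = (fun q => complex.Re (A q j i))) //.
  by apply/funext => q; rewrite !mxE Re_conj.
rewrite (_ : (fun q => _) = (fun q => - complex.Im (A q j i))).
  exact: (CkN _ _ _ oD C2).
by apply/funext => q; rewrite !mxE Im_conj.
Qed.

Lemma Ck_mxM k l r c D (A : V -> 'M[R[i]]_(k, l)) (B : V -> 'M[R[i]]_(l, r)) :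
  open D -> Ck_mx c D A -> Ck_mx c D B -> Ck_mx c D (fun q => A q *m B q).
Proof.
move=> oD CA CB i j; split.
  rewrite (_ : (fun q => _) = (fun q => \sum_(s < l)
     (complex.Re (A q i s) * complex.Re (B q s j)
      - complex.Im (A q i s) * complex.Im (B q s j)))); last first.
    by apply/funext => q; rewrite mxE Re_sum; apply: eq_bigr => s _; rewrite ReM.
  apply: Ck_sum => // s; have [A1 A2] := CA i s; have [B1 B2] := CB s j.
  exact: (CkB _ _ _ _ oD (CkM _ _ _ _ oD A1 B1) (CkM _ _ _ _ oD A2 B2)).
rewrite (_ : (fun q => _) = (fun q => \sum_(s < l)
     (complex.Re (A q i s) * complex.Im (B q s j)
      + complex.Im (A q i s) * complex.Re (B q s j)))); last first.
  by apply/funext => q; rewrite mxE Im_sum; apply: eq_bigr => s _; rewrite ImM.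
apply: Ck_sum => // s; have [A1 A2] := CA i s; have [B1 B2] := CB s j.
exact: (CkD _ _ _ _ oD (CkM _ _ _ _ oD A1 B2) (CkM _ _ _ _ oD A2 B1)).
Qed.

Lemma su_dotE N (A B : 'M[R[i]]_N) :
  su_dot A B = - 2^-1 * complex.Re (\tr (A *m B)).
Proof.
rewrite /su_dot (_ : - 2^-1 = (- 2^-1 : R)%:C); last by rewrite rmorphN fmorphV rmorph_nat.
by rewrite ReM /= mul0r subr0.
Qed.

Lemma su_dotC N (A B : 'M[R[i]]_N) : su_dot A B = su_dot B A.
Proof. by rewrite /su_dot mxtrace_mulC. Qed.

Lemma su_dotDl N (A B C : 'M[R[i]]_N) : su_dot (A + B) C = su_dot A C + su_dot B C.
Proof. by rewrite !su_dotE mulmxDl raddfD ReD mulrDr. Qed.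

Lemma su_dotZl N (a : R) (A B : 'M[R[i]]_N) : su_dot (a%:C *: A) B = a * su_dot A B.
Proof. by rewrite !su_dotE -scalemxAl mxtraceZ ReM /= mul0r subr0 mulrCA. Qed.

Lemma su_dotNr N (A B : 'M[R[i]]_N) : su_dot A (- B) = - su_dot A B.
Proof. by rewrite !su_dotE mulmxN raddfN ReN mulrN. Qed.

Lemma is_derive_su_dot N p v (A B : V -> 'M[R[i]]_N) dA dB :
  is_derive_mx p v A dA -> is_derive_mx p v B dB ->
  is_derive p v (fun q => su_dot (A q) (B q)) (su_dot dA (B p) + su_dot (A p) dB).
Proof.
move=> HA HB; have H := is_derive_mxM HA HB.
have Hs := @is_derive_sum _ _ _ _ (fun i => fun q => complex.Re ((A q *m B q) i i))
  p v _ (fun i => (H i i).1).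
have -> : (fun q => su_dot (A q) (B q)) =
   (- 2^-1 : R) \*: (\sum_(i < N) (fun q => complex.Re ((A q *m B q) i i))).
  by apply/funext => q; rewrite su_dotE /mxtrace Re_sum fct_sumE.
apply: is_derive_eq (is_deriveZ _ Hs) _.
by rewrite !su_dotE -mulrDr -ReD -raddfD /= /mxtrace Re_sum.
Qed.

Lemma Ck_su_dot N c D (A B : V -> 'M[R[i]]_N) : open D ->
  Ck_mx c D A -> Ck_mx c D B -> Ck c D (fun q => su_dot (A q) (B q)).
Proof.
move=> oD CA CB; have CM := Ck_mxM oD CA CB.
rewrite (_ : (fun q => _) =
   (fun q => - 2^-1 * \sum_(i < N) complex.Re ((A q *m B q) i i))); last first.
  by apply/funext => q; rewrite su_dotE /mxtrace Re_sum.
by apply: (CkM _ _ _ _ oD (Ck_cst _ _ _)); apply: Ck_sum => // i; exact: (CM i i).1.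
Qed.

(** For anti-Hermitian A, -tr(A A) is the trace of A times its adjoint, the sum of the squared
    moduli of the entries. *)
Lemma su_dot_ge0 N (A : 'M[R[i]]_N) : A ^t* = - A -> 0 <= su_dot A A.
Proof.
move=> AN; rewrite -[X in su_dot _ X]opprK -AN su_dotNr su_dotE mulNr opprK.
apply: mulr_ge0; rewrite ?invr_ge0 // /mxtrace Re_sum; apply: sumr_ge0 => i _.
rewrite mxE Re_sum; apply: sumr_ge0 => j _.
rewrite !mxE ReM Re_conj Im_conj mulrN opprK.
by rewrite addr_ge0 // -expr2 sqr_ge0.
Qed.

Lemma su_dot_cauchy_schwarz N (A B : 'M[R[i]]_N) : A ^t* = - A -> B ^t* = - B ->
  su_dot A B ^+ 2 <= su_dot A A * su_dot B B.
Proof.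
move=> AN BN.
(* This is the squared length of x A + y B, which is anti-Hermitian because [x] and [y] are real. *)
have Q (x y : R) :
    0 <= x ^+ 2 * su_dot A A + 2 * x * y * su_dot A B + y ^+ 2 * su_dot B B.
  have := @su_dot_ge0 N (x%:C *: A + y%:C *: B).
  rewrite su_dotDl !su_dotZl ![su_dot _ (_ + _)]su_dotC !su_dotDl !su_dotZl.
  rewrite [su_dot B A]su_dotC => H.
  rewrite (_ : _ + _ = x * (x * su_dot A A + y * su_dot A B)
                       + y * (x * su_dot A B + y * su_dot B B)); last by ring.
  apply: H; rewrite !linearD /= map_mxD !linearZ /= !map_mxZ.
  have conj_real (a : R) : Num.conj (a%:C : R[i]) = a%:C := conjc_real a.
  by rewrite -/(A ^t*) -/(B ^t*) AN BN; congr (_ *: _ + _ *: _); exact: conj_real.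
move: (su_dot A A) (su_dot A B) (su_dot B B) Q => E F G Q.
have E0 : 0 <= E by have := Q 1 0; lra.
have G0 : 0 <= G by have := Q 0 1; lra.
have [E1|E1] := eqVneq E 0; last first.
  have E2 : 0 < E by rewrite lt_def E1.
  (* The choice (-F, E) turns the form into [E] times the Gram determinant. *)
  have := Q (- F) E; rewrite (_ : _ + _ = E * (E * G - F ^+ 2)); last by ring.
  by rewrite pmulr_rge0 // subr_ge0.
(* When [E] is zero, this choice gives the value -F^2 (G + 2), and G >= 0 then forces F^2 <= 0. *)
have := Q (- (G + 1)) F; rewrite E1 mul0r => H.
have : F ^+ 2 * (G + 2) <= 0 by move: H; nra.
by rewrite pmulr_lle0 //; lra.
Qed.

End ComplexMatrixFunctions.

(** * The associated surface: its mixed derivative and its metric components *)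

Section SurfaceGeometry.
Set Implicit Arguments.
Unset Strict Implicit.
Context {R : realType}.
Local Notation derive_mx := Defs.derive_mx.
Local Open Scope sesquilinear_scope.

(* The hypotheses say that A and B exchange the range and the kernel of the
   projector P, so A *m B preserves both. *)
Lemma mulmx_commute_idempotent N (P A B : 'M[R[i]]_N) :
  A *m P + P *m A = A -> B *m P + P *m B = B -> A *m B *m P = P *m (A *m B).
Proof.
move=> HA HB.
have AP : A *m P = A - P *m A by rewrite -[X in X - _]HA addrK.
have BP : B *m P = B - P *m B by rewrite -[X in X - _]HB addrK.
rewrite -mulmxA BP mulmxBr [A *m (P *m B)]mulmxA AP mulmxBl -[P *m A *m B]mulmxA.
by rewrite opprB addrC subrK.
Qed.

(* [A, B] is block diagonal with respect to P while [C, P] is off-diagonal. *)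
Lemma su_dot_commutator_normal N (P A B C : 'M[R[i]]_N) :
  A *m P + P *m A = A -> B *m P + P *m B = B ->
  su_dot (commutator_mx A B) (commutator_mx C P) = 0.
Proof.
move=> HA HB; set W := commutator_mx A B.
have WP : W *m P = P *m W.
  rewrite /W /commutator_mx mulmxBl mulmxBr.
  by rewrite (mulmx_commute_idempotent HA HB) (mulmx_commute_idempotent HB HA).
(* By cyclicity and W P = P W, tr(W C P) = tr(P W C) = tr(W P C), so the two traces cancel. *)
rewrite su_dotE /commutator_mx mulmxBr raddfB /= !mulmxA.
by rewrite [X in X - _]mxtrace_mulC !mulmxA -WP subrr mulr0.
Qed.

Variables (m n : nat) (D : set (R * R)) (X : R * R -> 'M[R[i]]_(m + n, m)).
Variable Z : R * R -> 'M[R[i]]_(m + n).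
Hypothesis oD : open D.
Hypothesis X_solution : sigma_model_solution D X.
Hypothesis Z_surface : associated_surface D X Z.

Let P := projP X.

Lemma projP_Ck c : Ck_mx c D P.
Proof.
have [[/(smooth_mx_Ck c) CX _] _] := X_solution.
apply: (Ck_mxD oD (Ck_mx_cst _ _ _)); apply: (Ck_mxN oD).
exact: (Ck_mxM oD CX (Ck_mx_adjoint oD CX)).
Qed.

Lemma projP_idempotent q : D q -> P q *m P q = P q.
Proof.
move=> Dq; have [[_ /(_ q Dq) XX] _] := X_solution.
rewrite /P /projP mulmxBl mul1mx mulmxBr mulmx1.
by rewrite mulmxA -[X q *m _ *m X q]mulmxA XX mulmx1 subrr subr0.
Qed.

Lemma derive_projP v q : D q ->
  derive_mx v P q *m P q + P q *m derive_mx v P q = derive_mx v P q.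
Proof.
move=> Dq; have dP := Ck_mx_is_derive v (@projP_Ck 1) Dq.
rewrite -(derive_mx_val (is_derive_mxM dP dP)).
by apply: (eq_on_derive_mx v oD Dq) => q' Dq'; exact: projP_idempotent.
Qed.

Lemma surface_Ck c : Ck_mx c D Z.
Proof. by have [/(smooth_mx_Ck c)] := Z_surface. Qed.

(** Differentiating d_R Z = -[d_R P, P] along L gives -[d_L d_R P, P] - [d_R P, d_L P], and the
    field equation removes the first term. *)
Lemma derive_LR_surface q : D q ->
  derive_mx (eL R) (derive_mx (eR R) Z) q =
  commutator_mx (derive_mx (eL R) P q) (derive_mx (eR R) P q).
Proof.
move=> Dq; have [_ harm] := X_solution; have [_ _ _ dZ] := Z_surface.
rewrite (eq_on_derive_mx _ oD Dq dZ).
have dP := Ck_mx_is_derive (eL R) (@projP_Ck 1) Dq.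
have dBP := Ck_mx_is_derive (eL R) (Ck_mx_derive (eR R) (@projP_Ck 2)) Dq.
rewrite (derive_mx_val (is_derive_mxN (is_derive_mx_commutator dBP dP))).
by rewrite harm // add0r /commutator_mx opprB.
Qed.

(** Symmetry is applied to [Z] itself, so the field equation is used only in its given order of
    derivatives. *)
Lemma derive_RL_surface q : D q ->
  derive_mx (eR R) (derive_mx (eL R) Z) q =
  commutator_mx (derive_mx (eL R) P q) (derive_mx (eR R) P q).
Proof.
move=> Dq; apply: etrans (derive_LR_surface Dq).
exact: (derive_mx_symmetric (eL R) (eR R) oD Dq (@surface_Ck 2)).
Qed.

Lemma derive_R_J_L q : D q -> 'D_(eR R) (J_L Z) q = 0.
Proof.
move=> Dq; have [_ _ dZ _] := Z_surface.
have H := Ck_mx_is_derive (eR R) (Ck_mx_derive (eL R) (@surface_Ck 2)) Dq.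
rewrite (@derive_val _ _ _ _ _ _ _ (is_derive_su_dot H H)).
rewrite derive_RL_surface // [X in _ + X]su_dotC dZ //.
by rewrite su_dot_commutator_normal ?addr0 //; exact: derive_projP.
Qed.

Lemma derive_L_J_R q : D q -> 'D_(eL R) (J_R Z) q = 0.
Proof.
move=> Dq; have [_ _ _ dZ] := Z_surface.
have H := Ck_mx_is_derive (eL R) (Ck_mx_derive (eR R) (@surface_Ck 2)) Dq.
rewrite (@derive_val _ _ _ _ _ _ _ (is_derive_su_dot H H)).
rewrite derive_LR_surface // [X in _ + X]su_dotC dZ // su_dotNr.
by rewrite su_dot_commutator_normal ?oppr0 ?addr0 //; exact: derive_projP.
Qed.

(** The adjoint commutes with differentiation, so the anti-Hermitian condition on [Z] can be
    differentiated on the open set [D]. *)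
Lemma derive_surface_antihermitian v q : D q ->
  (derive_mx v Z q) ^t* = - derive_mx v Z q.
Proof.
move=> Dq; have [_ suZ _ _] := Z_surface.
have H := Ck_mx_is_derive v (@surface_Ck 1) Dq.
rewrite -(derive_mx_val (is_derive_mx_adjoint H)) -(derive_mx_val (is_derive_mxN H)).
by apply: (eq_on_derive_mx v oD Dq) => q' Dq'; have [] := suZ _ Dq'.
Qed.

Lemma G_LR_cauchy_schwarz q : D q -> G_LR Z q ^+ 2 <= J_L Z q * J_R Z q.
Proof.
by move=> Dq; apply: su_dot_cauchy_schwarz; exact: derive_surface_antihermitian.
Qed.

Lemma J_L_ge0 q : D q -> 0 <= J_L Z q.
Proof. by move=> Dq; apply: su_dot_ge0; exact: derive_surface_antihermitian. Qed.

End SurfaceGeometry.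

(** * Gaussian curvature of the surface of a sigma model solution *)

Theorem mainTheorem2 (R : realType) (m n : nat) (hm : (1 <= m)%N) (hn : (1 <= n)%N)
  (Omega : set (R * R))
  (Omega_open : open Omega)
  (Omega_connected : connected Omega)
  (Omega_simply_connected : simply_connected Omega)
  (X : R * R -> 'M[R[i]]_(m + n, m))
  (X_solution : sigma_model_solution Omega X)
  (Z : R * R -> 'M[R[i]]_(m + n))
  (Z_surface : associated_surface Omega X Z)
  (det_neq0 : forall p : R * R, Omega p ->
     J_L Z p * J_R Z p - G_LR Z p ^+ 2 != 0) :
  forall p : R * R, Omega p ->
    gaussian_curvature (@frameLR R) (induced_metric Z) p =
    (Num.sqrt (J_L Z p * J_R Z p - G_LR Z p ^+ 2))^-1 *
    'D_(eR R) (fun q : R * R =>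
       ('D_(eL R) (G_LR Z) q
        - 2^-1 * G_LR Z q * 'D_(eL R) (fun q' : R * R => ln (J_L Z q')) q)
       / Num.sqrt (J_L Z q * J_R Z q - G_LR Z q ^+ 2)) p.
Proof.
move=> p Dp.
have dJL q : Omega q -> 'D_(frameLR R 1) (J_L Z) q = 0.
  exact: (derive_R_J_L Omega_open X_solution Z_surface).
have dJR q : Omega q -> 'D_(frameLR R 0) (J_R Z) q = 0.
  exact: (derive_L_J_R Omega_open X_solution Z_surface).
(* Order 3 for [Z] makes its first derivatives, and hence the metric components, of class C^2. *)
have CL := Ck_mx_derive (eL R) (surface_Ck Z_surface 3).
have CR := Ck_mx_derive (eR R) (surface_Ck Z_surface 3).
have det_pos q : Omega q -> 0 < J_L Z q * J_R Z q - G_LR Z q ^+ 2.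
  move=> Dq; rewrite lt_def det_neq0 // subr_ge0.
  exact: (G_LR_cauchy_schwarz Omega_open Z_surface Dq).
(* If [J_L] vanished, the determinant would be minus a square, against its positivity. *)
have J_L_pos q : Omega q -> 0 < J_L Z q.
  move=> Dq; rewrite lt_def (J_L_ge0 Omega_open Z_surface Dq) andbT.
  apply/eqP => J0; have := det_pos q Dq.
  by rewrite J0 mul0r sub0r oppr_gt0 ltNge sqr_ge0.
have g01 q : induced_metric Z q 0 1 = G_LR Z q by rewrite mxE.
have g10 q : induced_metric Z q 1 0 = G_LR Z q by rewrite mxE; exact: su_dotC.
have g00 q : induced_metric Z q 0 0 = J_L Z q by rewrite mxE.
have g11 q : induced_metric Z q 1 1 = J_R Z q by rewrite mxE.
exact: (chebyshev_net_curvature Omega (frameLR R) (induced_metric Z)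
  (J_L Z) (G_LR Z) (J_R Z) g00 g01 g10 g11 Omega_open
  (Ck_su_dot Omega_open CL CL) (Ck_su_dot Omega_open CL CR)
  (Ck_su_dot Omega_open CR CR) J_L_pos det_pos dJL dJR p Dp).
Qed.
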